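(* Let $a,b,m,n$ be nonnegative integers such that $a>0$ and $na\geq m$. Then $A(b,a;na,m)\in\mathbb{Z}[q]$ if and only if $\gcd(a,m)\mid b$.
   Context: $\mathbb{N}$ is the set of positive integers and $\mathbb{N}_0=\mathbb{N}\cup\{0\}$. $\mathbb{Z}[q]$ is the ring of polynomials in the indeterminate $q$ with integer coefficients. Let $(q;q)_0=1$ and $(q;q)_n=\prod_{i=1}^{n}(1-q^i)$. For $m,n\in\mathbb{N}_0$ the $q$-binomial coefficient is $\left[{n\atop m}\right]=\frac{(q;q)_n}{(q;q)_m(q;q)_{n-m}}$ if $n\geq m\geq 0$, and $0$ otherwise. For $a\in\mathbb{N}$ and $b,m,n\in\mathbb{N}_0$ define the rational function of $q$ $$A(b,a;n,m)=\frac{1-q^b}{1-q^a}\left[{n\atop m}\right].$$ The statement $A(b,a;n,m)\in\mathbb{Z}[q]$ means that this rational function is a polynomial in $q$ with integer coefficients. *)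

(* Defs.v *)
From mathcomp Require Import all_boot all_algebra.
Import GRing.Theory.
Local Open Scope ring_scope.

(* Since Z[q] is a domain with field of fractions Q(q), rational functions of q
   are elements of {fraction {poly int}}. *)
Notation ratfun := {fraction {poly int}}.

Definition qvar : ratfun := tofrac 'X.

(* (q;q)_n *)
Definition qpoch (n : nat) : ratfun := \prod_(1 <= i < n.+1) (1 - qvar ^+ i).

Definition qbinom (n m : nat) : ratfun :=
  if (m <= n)%N then qpoch n / (qpoch m * qpoch (n - m)) else 0.

(* Only meaningful for a > 0: when a = 0 the denominator vanishes. *)
Definition A (b a n m : nat) : ratfun :=
  (1 - qvar ^+ b) / (1 - qvar ^+ a) * qbinom n m.

Definition in_Zq (f : ratfun) : Prop := exists p : {poly int}, f = tofrac p.

(* Main.v *)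
Require Import Defs.
From mathcomp Require Import all_boot all_algebra.
From mathcomp Require Import algC cyclotomic ring.

(** Clearing denominators turns the claim into divisibility in Z[q]: with
    [B] the Gaussian polynomial of (na choose m), the rational function lies in
    Z[q] exactly when [1 - q^a] divides [(1 - q^b) B]
    ([in_Zq_A_iff_divides]).  Put [g = gcd(a, m)].

    If [g] divides [b], it is enough to treat [b = g].  A Bezout relation puts
    [1 - q^g] in the ideal of [1 - q^a] and [1 - q^m]
    ([one_subX_gcd_in_ideal]).  The first generator is harmless, and the
    absorption identity [(1 - q^m) (na choose m) = (1 - q^(na)) (na-1 choose m-1)]
    ([gauss_absorb]) makes the second harmless too, since [1 - q^a] divides
    [1 - q^(na)].

    Conversely, specialize [q] to a primitive [g]-th root of unity [z].  As [g]
    divides [a], the divisor [1 - q^a] vanishes, while [B] does not: [g] divides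
    [m] and [na - m], so the factors of numerator and denominator that vanish at
    [z] match up and their quotients tend to nonzero rationals
    ([gauss_unity_root_neq0]; by the q-Lucas theorem the value is the binomial
    coefficient of [na/g] and [m/g]).  Hence [z^b = 1], that is, [g] divides
    [b]. *)

Set Implicit Arguments.
Unset Strict Implicit.
Unset Printing Implicit Defensive.

Import GRing.Theory Num.Theory.
Local Open Scope ring_scope.

Definition qfact (n : nat) : {poly int} := \prod_(i < n) (1 - 'X^(i.+1)).

(** [B] is the Gaussian polynomial of (m+k choose m).  The equation has no
    denominators, so identities between Gaussian polynomials can be proved by
    cancelling nonzero elements of the domain Z[q]. *)
Definition is_gauss (m k : nat) (B : {poly int}) : Prop :=
  B * (qfact m * qfact k) = qfact (m + k).

Lemma qfact0 : qfact 0 = 1.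
Proof. exact: big_ord0. Qed.

Lemma qfactS n : qfact n.+1 = qfact n * (1 - 'X^(n.+1)).
Proof. exact: big_ord_recr. Qed.

Lemma one_subXn_neq0 n : (0 < n)%N -> 1 - 'X^n != 0 :> {poly int}.
Proof. by move=> n0; rewrite -opprB oppr_eq0 -size_poly_eq0 size_XnsubC. Qed.

Lemma qfact_neq0 n : qfact n != 0.
Proof. by apply/prodf_neq0 => i _; exact: one_subXn_neq0. Qed.

Lemma qpochE n : qpoch n = tofrac (qfact n).
Proof.
rewrite /qpoch big_add1 big_mkord rmorph_prod; apply: eq_bigr => i _.
by rewrite rmorphB rmorph1 rmorphXn.
Qed.

(** The q-Pascal rule [(n+1 choose m+1) = (n choose m) + q^(m+1) (n choose m+1)]
    builds the Gaussian polynomial. *)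
Lemma gauss_exists m k : exists B, is_gauss m k B.
Proof.
elim: m k => [|m IHm] k; first by exists 1; rewrite /is_gauss qfact0 !mul1r.
elim: k => [|k [B2 HB2]]; first by exists 1; rewrite /is_gauss qfact0 addn0 mulr1 mul1r.
have [B1 HB1] := IHm k.+1.
exists (B1 + 'X^(m.+1) * B2).
rewrite /is_gauss.
have -> : (B1 + 'X^(m.+1) * B2) * (qfact m.+1 * qfact k.+1) =
  B1 * (qfact m * qfact k.+1) * (1 - 'X^(m.+1))
  + 'X^(m.+1) * (B2 * (qfact m.+1 * qfact k)) * (1 - 'X^(k.+1)).
  by rewrite !qfactS; ring.
rewrite HB1 HB2 addSnnS [in RHS]addSn qfactS.
by rewrite -[(m + k.+1).+1]addSn exprD; ring.
Qed.

(** The witness is the Gaussian polynomial of (m+k-1 choose m-1), or 0 when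
    [m = 0], where the left-hand side vanishes. *)
Lemma gauss_absorb m k B : is_gauss m k B ->
  exists B', (1 - 'X^m) * B = (1 - 'X^(m + k)) * B'.
Proof.
case: m => [|m] HB; first by exists 0; rewrite expr0 subrr mul0r mulr0.
have [B' HB'] := gauss_exists m k; exists B'.
have nz : qfact m * qfact k != 0 by rewrite mulf_neq0 ?qfact_neq0.
apply: (mulIf nz).
rewrite -(mulrA (1 - 'X^(m.+1 + k))) HB' addSn mulrC [RHS]mulrC -qfactS -addSn -HB.
by rewrite qfactS; ring.
Qed.

Lemma one_subXn_dvd a n : exists c : {poly int}, 1 - 'X^(n * a) = c * (1 - 'X^a).
Proof.
exists (\sum_(i < n) 'X^(a * i)).
rewrite mulrC mulnC exprM -[1 in LHS](expr1n _ n) subrXX.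
by congr (_ * _); apply: eq_bigr => i _; rewrite expr1n mul1r exprM.
Qed.

(** If [u a = g + v m], then [1 - q^(u a) = (1 - q^g) + q^g (1 - q^(v m))]. *)
Lemma one_subX_gcd_in_ideal a m : (0 < a)%N ->
  exists P Q : {poly int},
    1 - 'X^(gcdn a m) = P * (1 - 'X^a) + Q * (1 - 'X^m).
Proof.
move=> a0; case: (egcdnP m a0) => u v Euv _.
have [c Hc] := one_subXn_dvd a u; have [d Hd] := one_subXn_dvd m v.
exists c, (- 'X^(gcdn a m) * d).
rewrite -mulrA -Hc -Hd Euv exprD.
by ring.
Qed.

Lemma in_Zq_A_iff_divides a b m k B : (0 < a)%N -> is_gauss m k B ->
  in_Zq (A b a (m + k) m) <-> exists p, (1 - 'X^b) * B = p * (1 - 'X^a).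
Proof.
move=> a0 HB.
have nz : tofrac (1 - 'X^a : {poly int}) != 0.
  by rewrite tofrac_eq0 one_subXn_neq0.
have EA : A b a (m + k) m = tofrac ((1 - 'X^b) * B) / tofrac (1 - 'X^a).
  rewrite /A /qbinom leq_addr addKn !qpochE -HB -!rmorphM /=.
  rewrite [tofrac (B * _)]rmorphM mulfK; last first.
    by rewrite tofrac_eq0 mulf_neq0 ?qfact_neq0.
  by rewrite !rmorphM !rmorphB !rmorph1 !rmorphXn /= mulrAC.
rewrite EA; split=> [] [p Hp]; exists p.
  by apply/eqP; rewrite -tofrac_eq [tofrac (p * _)]rmorphM /= -Hp divfK.
by rewrite Hp rmorphM mulfK.
Qed.

Section UnityRoot.

Variables (ev : {rmorphism {poly int} -> algC}) (g : nat).
Hypothesis evX : g.-primitive_root (ev 'X).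

Lemma ev_one_subXn_eq0 i : (ev (1 - 'X^i) == 0) = (g %| i)%N.
Proof.
by rewrite rmorphB rmorph1 rmorphXn subr_eq0 eq_sym (prim_order_dvd evX).
Qed.

(** The cofactor [1 + q^g + ... + q^(g (j-1))] specializes to [j], which is
    nonzero in characteristic 0: the vanishing is of the same order for all
    positive multiples of [g]. *)
Lemma one_subXn_simple_zero i : (0 < i)%N -> (g %| i)%N ->
  exists2 U, 1 - 'X^i = (1 - 'X^g) * U & ev U != 0.
Proof.
move=> i0 /dvdnP[j Ej]; move: i0; rewrite Ej muln_gt0 => /andP[j0 _].
exists (\sum_(l < j) ('X^g) ^+ l).
  rewrite mulnC exprM -[1 in LHS](expr1n _ j) subrXX.
  by congr (_ * _); apply: eq_bigr => l _; rewrite expr1n mul1r.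
rewrite rmorph_sum (eq_bigr (fun=> 1)) => [|l _].
  by rewrite sumr_const card_ord pnatr_eq0 -lt0n.
by rewrite !rmorphXn /= (prim_expr_order evX) expr1n.
Qed.

Lemma one_subXn_same_order i k : (0 < i)%N -> (g %| k)%N ->
  exists D U V, [/\ D != 0, 1 - 'X^i = D * U, 1 - 'X^(i + k) = D * V,
                   ev U != 0 & ev V != 0].
Proof.
move=> i0 gk; have [gi|gi] := boolP (g %| i)%N; last first.
  exists 1, (1 - 'X^i), (1 - 'X^(i + k)).
  by split; rewrite ?mul1r ?oner_neq0 // ev_one_subXn_eq0 // dvdn_addl.
have [U EU nzU] := one_subXn_simple_zero i0 gi.
have [|V EV nzV] := @one_subXn_simple_zero (i + k) _ (dvdn_add gi gk).
  by rewrite addn_gt0 i0.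
exists (1 - 'X^g), U, V; split=> //.
by rewrite one_subXn_neq0 ?(prim_order_gt0 evX).
Qed.

(** The factor [1 - q^(i+k)] of [(q;q)_(m+k) / (q;q)_k] is paired with the
    factor [1 - q^i] of [(q;q)_m]: both vanish or neither does, because [g]
    divides [k]. *)
Lemma qfact_same_order m k : (g %| k)%N ->
  exists D U V, [/\ D != 0, qfact m = D * U, qfact (m + k) = D * V * qfact k,
                   ev U != 0 & ev V != 0].
Proof.
move=> gk; elim: m => [|m [D [U [V [nzD EU EV nzU nzV]]]]].
  by exists 1, 1, 1; split; rewrite ?qfact0 ?mul1r ?rmorph1 ?oner_neq0.
have [D' [U' [V' [nzD' EU' EV' nzU' nzV']]]] := one_subXn_same_order (ltn0Sn m) gk.
exists (D * D'), (U * U'), (V * V'); split; rewrite ?rmorphM ?mulf_neq0 //.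
  by rewrite qfactS EU EU'; ring.
by rewrite addSn qfactS EV -addSn EV'; ring.
Qed.

(** Cancelling the common vanishing part [D] of [(q;q)_m] and
    [(q;q)_(m+k) / (q;q)_k] leaves [B U = V] with [U] and [V] nonvanishing. *)
Lemma gauss_unity_root_neq0 m k B :
  (g %| k)%N -> is_gauss m k B -> ev B != 0.
Proof.
move=> gk HB; have [D [U [V [nzD EU EV nzU nzV]]]] := qfact_same_order m gk.
have EBU : B * U = V.
  apply: (mulfI nzD); apply: (mulIf (qfact_neq0 k)).
  by rewrite -EV -HB EU; ring.
by apply: contraNneq nzV => B0; rewrite -EBU rmorphM B0 mul0r.
Qed.

End UnityRoot.

Lemma primitive_specialization g : (0 < g)%N ->
  exists ev : {rmorphism {poly int} -> algC}, g.-primitive_root (ev 'X).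
Proof.
move=> g0; have [z Hz] := C_prim_root_exists g0.
exists (horner_eval z \o map_poly intr).
by rewrite /= map_polyX /horner_eval hornerX.
Qed.

Local Close Scope ring_scope.

Theorem theorem2 (a b m n : nat) (ha : 0 < a) (hm : m <= n * a) :
  in_Zq (A b a (n * a) m) <-> gcdn a m %| b.
Proof.
move: (subnKC hm); set k := n * a - m => Ek.
have [B HB] := gauss_exists m k.
rewrite -Ek (in_Zq_A_iff_divides b ha HB); split=> [[p Hp]|/dvdnP[j Ej]].
- have g0 : 0 < gcdn a m by rewrite gcdn_gt0 ha.
  have [ev evX] := primitive_specialization g0.
  have gk : gcdn a m %| k by rewrite dvdn_sub ?dvdn_gcdr ?dvdn_mull ?dvdn_gcdl.
  have := congr1 ev Hp; rewrite !rmorphM.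
  have /eqP-> : ev (1 - 'X^a)%R == 0%R by rewrite (ev_one_subXn_eq0 evX) dvdn_gcdl.
  move/eqP; rewrite mulr0 mulf_eq0 (ev_one_subXn_eq0 evX).
  by rewrite (negPf (gauss_unity_root_neq0 evX gk HB)) orbF.
- have [c Hc] := one_subXn_dvd (gcdn a m) j.
  have [d Hd] := one_subXn_dvd a n.
  have [P [Q HPQ]] := one_subX_gcd_in_ideal m ha.
  have [B' HB'] := gauss_absorb HB.
  exists (c * (P * B + Q * (d * B')))%R.
  rewrite Ej Hc HPQ.
  have -> : (c * (P * (1 - 'X^a) + Q * (1 - 'X^m)) * B
    = c * (P * B * (1 - 'X^a) + Q * ((1 - 'X^m) * B)))%R by ring.
  by rewrite HB' Ek Hd; ring.
Qed.
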